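(* Let $p$ be a prime and let $G=Q_{4p^2}$. Then $\mathcal{B}(G)$ is hypoenergetic, and it is not hyperenergetic, not L-hyperenergetic, not Q-hyperenergetic and not CN-hyperenergetic.
   Context: $Q_{4m}=\langle a,b : a^{2m}=1,\ b^2=a^m,\ bab^{-1}=a^{-1}\rangle$ is the dicyclic group of order $4m$. For a finite group $G$, let $L(G)$ be the set of all subgroups of $G$. The subgroup generating bipartite graph $\mathcal{B}(G)$ is the simple bipartite graph with vertex set the disjoint union of $G\times G$ and $L(G)$, in which $(a,b)\in G\times G$ and $H\in L(G)$ are adjacent if and only if $H$ is the subgroup generated by $a$ and $b$ (and there are no other edges). For a finite simple graph $\Gamma$ with $n$ vertices $v_1,\dots,v_n$ and $m$ edges, let $A$ be its adjacency matrix, $D$ its diagonal degree matrix, and $CN(\Gamma)$ the common neighborhood matrix, whose $(i,j)$ entry for $i\neq j$ is the number of vertices other than $v_i,v_j$ adjacent to both $v_i$ and $v_j$, with zero diagonal. The energy $E(\Gamma)$ and the common neighborhood energy $E_{CN}(\Gamma)$ are the sums of absolute values of the eigenvalues (with multiplicity) of $A$ and $CN(\Gamma)$ respectively. The Laplacian energy is $LE(\Gamma)=\sum_{\lambda}|\lambda-\frac{2m}{n}|$ over the eigenvalues $\lambda$ of $D-A$, and the signless Laplacian energy is $LE^+(\Gamma)=\sum_{\mu}|\mu-\frac{2m}{n}|$ over the eigenvalues $\mu$ of $D+A$ (both counted with multiplicity). With $K_n$ the complete graph on $n=|V(\Gamma)|$ vertices, $\Gamma$ is called hypoenergetic if $E(\Gamma)<n$;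 hyperenergetic if $E(\Gamma)>E(K_n)$; L-hyperenergetic if $LE(\Gamma)>LE(K_n)$; Q-hyperenergetic if $LE^+(\Gamma)>LE^+(K_n)$; CN-hyperenergetic if $E_{CN}(\Gamma)>E_{CN}(K_n)$. Here $E(K_n)=LE(K_n)=LE^+(K_n)=2(n-1)$ and $E_{CN}(K_n)=2(n-1)(n-2)$. *)

(* Defs.v *)
From HB Require Import structures.
From mathcomp Require Import all_boot all_order all_algebra all_fingroup.
From mathcomp Require Import all_field.

Set Implicit Arguments.
Unset Strict Implicit.
Unset Printing Implicit Defensive.

Import Order.TTheory GRing.Theory Num.Theory.
Local Open Scope ring_scope.

Record sgraph := SGraph {
  vertex :> finType;
  adj : rel vertex;
  adj_sym : symmetric adj;
  adj_irrefl : irreflexive adj }.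

Definition edges (S : sgraph) : {set {set S}} :=
  [set [set x; y] | x in S, y in S & adj x y].

Definition degree (S : sgraph) (x : S) : nat := #|[set y | adj x y]|.

Definition common_neighbors (S : sgraph) (x y : S) : {set S} :=
  [set z | [&& z != x, z != y, adj x z & adj y z]].

(* Matrices are indexed by positions in the enumeration of the vertices. *)
Definition adjacency_mx (S : sgraph) : 'M[algC]_#|S| :=
  \matrix_(i, j) (adj (enum_val i) (enum_val j))%:R.

Definition degree_mx (S : sgraph) : 'M[algC]_#|S| :=
  diag_mx (\row_i (degree (enum_val i))%:R).

Definition common_neighborhood_mx (S : sgraph) : 'M[algC]_#|S| :=
  \matrix_(i, j)
    if i == j then 0 else #|common_neighbors (enum_val i) (enum_val j)|%:R.

(* The roots of the characteristic polynomial, repeated according to their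
   multiplicity; the order of the list is irrelevant below. *)
Definition spectrum (n : nat) (A : 'M[algC]_n) : seq algC :=
  sval (closed_field_poly_normal (char_poly A)).

Lemma spectrumP (n : nat) (A : 'M[algC]_n) :
  char_poly A = \prod_(z <- spectrum A) ('X - z%:P).
Proof.
rewrite /spectrum; case: closed_field_poly_normal => r /= {1}->.
by rewrite (monicP (char_poly_monic A)) scale1r.
Qed.

(* The energies are sums of norms, hence nonnegative reals of algC: any two of
   them are comparable for the partial order of algC. *)
Definition abs_dev_sum (s : seq algC) (c : algC) : algC :=
  \sum_(z <- s) `|z - c|.

Definition average_degree (S : sgraph) : algC :=
  (2 * #|edges S|)%N%:R / #|S|%:R.

Definition energy (S : sgraph) : algC :=
  \sum_(z <- spectrum (adjacency_mx S)) `|z|.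

Definition CN_energy (S : sgraph) : algC :=
  \sum_(z <- spectrum (common_neighborhood_mx S)) `|z|.

Definition laplacian_energy (S : sgraph) : algC :=
  abs_dev_sum (spectrum (degree_mx S - adjacency_mx S)) (average_degree S).

Definition signless_laplacian_energy (S : sgraph) : algC :=
  abs_dev_sum (spectrum (degree_mx S + adjacency_mx S)) (average_degree S).

Section CompleteGraph.
Variable n : nat.

Definition complete_adj : rel 'I_n := fun i j => i != j.

Lemma complete_adj_sym : symmetric complete_adj.
Proof. by move=> i j; rewrite /complete_adj eq_sym. Qed.

Lemma complete_adj_irrefl : irreflexive complete_adj.
Proof. by move=> i; rewrite /complete_adj eqxx. Qed.

Definition complete_graph : sgraph :=
  SGraph complete_adj_sym complete_adj_irrefl.

End CompleteGraph.

Definition hypoenergetic (S : sgraph) : bool := energy S < #|S|%:R.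

Definition hyperenergetic (S : sgraph) : bool :=
  energy S > energy (complete_graph #|S|).

Definition L_hyperenergetic (S : sgraph) : bool :=
  laplacian_energy S > laplacian_energy (complete_graph #|S|).

Definition Q_hyperenergetic (S : sgraph) : bool :=
  signless_laplacian_energy S
    > signless_laplacian_energy (complete_graph #|S|).

Definition CN_hyperenergetic (S : sgraph) : bool :=
  CN_energy S > CN_energy (complete_graph #|S|).

Section SubgroupGeneratingBipartiteGraph.
Variable gT : finGroupType.

Definition sgb_adj : rel (gT * gT + {group gT}) := fun u v =>
  match u, v with
  | inl (a, b), inr H | inr H, inl (a, b) => H == <<[set a; b]>>%G
  | _, _ => false
  end.

Lemma sgb_adj_sym : symmetric sgb_adj.
Proof. by move=> [[a b]|H] [[c d]|K]. Qed.

Lemma sgb_adj_irrefl : irreflexive sgb_adj.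
Proof. by move=> [[a b]|H]. Qed.

Definition sgb_graph : sgraph := SGraph sgb_adj_sym sgb_adj_irrefl.

End SubgroupGeneratingBipartiteGraph.

(* [gT] is a model of the dicyclic group Q_(4m), of order 4m for m >= 1. As this
   group is finite, [\isog Grp] does characterize it up to isomorphism. *)
Definition is_dicyclic (m : nat) (gT : finGroupType) : Prop :=
  ([set: gT] \isog Grp (a : b : a ^+ (2 * m), b ^+ 2 = a ^+ m,
                                b * a * b^-1 = a^-1))%g.

(* Main.v *)
Require Import Defs.
From mathcomp Require Import all_boot all_order all_algebra all_fingroup.
From mathcomp Require Import all_field.
From mathcomp Require Import ring zify.

Set Implicit Arguments.
Unset Strict Implicit.
Unset Printing Implicit Defensive.

Import Order.TTheory GRing.Theory Num.Theory.
Local Open Scope ring_scope.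

(** Every pair (a, b) has exactly one neighbour, the subgroup it generates, so
the graph is a disjoint union of stars: one star for each subgroup H, centred
at H, whose leaves are the d_H pairs generating H.  Write n = |G|^2 for the
number of pairs, l for the number of subgroups and N = n + l for the number of
vertices; thus \sum_H d_H = n.  A star with d leaves has explicit spectra:
- adjacency: sqrt d, - sqrt d, and 0 with multiplicity d - 1;
- Laplacian and signless Laplacian: 0, d + 1, and 1 with multiplicity d - 1;
- common neighbourhoods: d - 1, 0, and - 1 with multiplicity d - 1, because the
  leaves form a clique and the centre is isolated.

These multiplicities make sense only for d >= 1, while d_H = 0 when H needs
more than two generators.  [sum_spectrum_star] and [sum_spectrum_cliques]
therefore move the negative contributions to the other side: they compare two
lists of roots after multiplying the characteristic polynomial by l linear
factors.  The characteristic polynomials themselves come from a Schur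
complement, since the pairs-by-subgroups incidence matrix B satisfies
B^T B = diag (d_H).

The estimates are then elementary.
- The energy is \sum_H 2 sqrt d_H <= \sum_H (d_H + 1) = N.  Equality would
  force d_H = 1 for all H, but <<x>> with x <> 1 is generated by both (x, 1)
  and (1, x); and G is nontrivial because the dicyclic group maps onto the
  group of order 2.
- With average degree c = 2n / N, both Laplacian energies equal
  |1 - c| (n - l) + \sum_H (c + |d_H + 1 - c|), and the triangle inequality
  |d_H + 1 - c| <= d_H + |1 - c| bounds this by |1 - c| n + c l + n.  This is
  c N = 2n if l <= n, and at most N otherwise; both are at most 2 (N - 1).
- The common neighbourhood energy is n - l + \sum_H |d_H - 1| <= 2n,
  which is at most 2 (N - 1) (N - 2).

The energies of the complete graph have to be bounded from below only.  If A
has trace N c and an eigenvalue mu, then the deviations z - c of its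
eigenvalues sum to 0, so their absolute values sum to at least 2 |mu - c|
([abs_dev_sum_ge]).  All four matrices of the complete graph have a constant
diagonal and constant off-diagonal entries, so the all-ones vector provides
the eigenvalue that is needed. *)

(** * Characteristic polynomials of star and clique matrices *)

(** Conjugation by a permutation matrix; it frees the computations below from
the order in which the vertices are enumerated. *)
Lemma char_poly_reindex (R : comNzRingType) (m n : nat) (g : 'I_m -> 'I_n)
    (A : 'M[R]_n) :
  bijective g -> char_poly (mxsub g g A) = char_poly A.
Proof.
move=> bij_g; have inj_g := bij_inj bij_g.
have mn : m = n by rewrite -[m]card_ord (bij_eq_card bij_g) card_ord.
subst m; pose s := perm inj_g; rewrite /char_poly.
have ->: char_poly_mx (mxsub g g A) = row_perm s (col_perm s (char_poly_mx A)).
  by apply/matrixP => i j; rewrite !mxE !permE (inj_eq inj_g).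
rewrite row_permE col_permE !det_mulmx !det_perm odd_permV mulrCA.
by rewrite -signr_addb addbb mulr1.
Qed.

(** The Schur complement of the scalar block is diagonal because [B^T *m B] is.
Multiplying on the right by [block_mx 1 C 0 x], of determinant [x ^+ l], clears
the upper right corner without dividing by [x], so that the identity holds over
any commutative ring. *)
Lemma char_poly_star (R : comNzRingType) (n l : nat) (B : 'M[R]_(n, l))
    (d g : 'rV[R]_l) (a b : R) :
  B^T *m B = diag_mx d ->
  char_poly (block_mx a%:M (b *: B) (b *: B^T) (diag_mx g)) * ('X - a%:P) ^+ l
  = ('X - a%:P) ^+ n
    * \prod_j (('X - a%:P) * ('X - (g 0 j)%:P) - (b ^+ 2 * d 0 j)%:P).
Proof.
move=> BtB; pose x : {poly R} := 'X - a%:P.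
pose C := map_mx polyC (b *: B).
have CtC : C^T *m C = diag_mx (\row_j (b ^+ 2 * d 0 j)%:P).
  have bBt : (b *: B)^T = b *: B^T by apply/matrixP => i j; rewrite !mxE.
  rewrite map_trmx -map_mxM bBt -scalemxAl -scalemxAr scalerA BtB -expr2.
  by apply/matrixP => i j; rewrite !mxE mulrnAr rmorphMn.
have ->: char_poly (block_mx a%:M (b *: B) (b *: B^T) (diag_mx g))
    = \det (block_mx x%:M (- C) (- C^T) (diag_mx (\row_j ('X - (g 0 j)%:P)))).
  rewrite /char_poly /char_poly_mx scalar_mx_block map_block_mx opp_block_mx.
  rewrite add_block_mx !add0r; congr (\det (block_mx _ _ _ _)).
  - by apply/matrixP => i j; rewrite !mxE rmorphMn mulrnBl.
  - by apply/matrixP => i j; rewrite !mxE.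
  - apply/matrixP => i j; rewrite !mxE rmorphMn mulrnBl //.
have detT : \det (block_mx 1%:M C 0 x%:M) = x ^+ l.
  by rewrite det_ublock det1 det_scalar mul1r.
rewrite -[in LHS]/x -detT -det_mulmx mulmx_block !mulmx1 !mulmx0 !addr0.
rewrite mul_scalar_mx !mulNmx CtC !mul_mx_scalar subrr.
rewrite det_lblock det_scalar; congr (_ * _).
transitivity (\det (diag_mx
    (\row_j (x * ('X - (g 0 j)%:P) - (b ^+ 2 * d 0 j)%:P)))); last first.
  by rewrite det_diag; apply: eq_bigr => j _; rewrite mxE.
congr (\det _); apply/matrixP => i j; rewrite !mxE.
by rewrite mulrnAr mulrnBl addrC.
Qed.

(** Both sides are computed from [S], the matrix with blocks [x], [C], [C^T] and
[1]: its two Schur complements are [x - C *m C^T] and, up to the factor [x],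
[x - C^T *m C], which is diagonal. *)
Lemma char_poly_cliques (R : comNzRingType) (n l : nat) (B : 'M[R]_(n, l))
    (d : 'rV[R]_l) :
  B^T *m B = diag_mx d ->
  char_poly (block_mx (B *m B^T - 1%:M) 0 0 (0 : 'M_l)) * ('X + 1) ^+ l
  = 'X ^+ l * ('X + 1) ^+ n * \prod_j ('X + 1 - (d 0 j)%:P).
Proof.
move=> BtB; pose x : {poly R} := 'X + 1; pose C := map_mx polyC B.
have CtC : C^T *m C = diag_mx (\row_j (d 0 j)%:P).
  rewrite map_trmx -map_mxM BtB.
  by apply/matrixP => i j; rewrite !mxE rmorphMn.
have ->: char_poly (block_mx (B *m B^T - 1%:M) 0 0 (0 : 'M_l))
    = 'X ^+ l * \det (x%:M - C *m C^T).
  rewrite /char_poly /char_poly_mx scalar_mx_block map_block_mx opp_block_mx.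
  rewrite add_block_mx !map_mx0 !subr0.
  rewrite det_ublock det_scalar mulrC; congr (_ * \det _).
  rewrite map_trmx -map_mxM; apply/matrixP => i j.
  by rewrite !mxE rmorphB rmorphMn /= mulrnDl opprB addrA.
rewrite -!mulrA; congr (_ * _).
pose S := block_mx x%:M C C^T 1%:M.
have ->: \det (x%:M - C *m C^T) = \det S.
  transitivity (\det (S *m block_mx 1%:M 0 (- C^T) 1%:M)).
    rewrite mulmx_block !mulmx0 !mulmx1 !mul1mx mulmxN add0r addrN add0r.
    by rewrite det_ublock det1 mulr1.
  by rewrite det_mulmx det_lblock !det1 !mulr1.
have detT : \det (block_mx 1%:M (- C) 0 x%:M) = x ^+ l.
  by rewrite det_ublock det1 det_scalar mul1r.
rewrite -[in LHS]/x -detT -det_mulmx mulmx_block !mulmx1 !mulmx0 !addr0.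
rewrite !mulmxN CtC mul_scalar_mx mul_mx_scalar addNr mul1mx.
rewrite det_lblock det_scalar; congr (_ * _).
transitivity (\det (diag_mx (\row_j (x - (d 0 j)%:P)))); last first.
  by rewrite det_diag; apply: eq_bigr => j _; rewrite mxE.
congr (\det _); apply/matrixP => i j; rewrite !mxE.
by rewrite mulrnBl addrC.
Qed.

(** * Sums over the spectrum *)

Lemma sum_spectrum_factored (n : nat) (A : 'M[algC]_n) (s t : seq algC)
    (phi : algC -> algC) :
  char_poly A * \prod_(z <- s) ('X - z%:P) = \prod_(z <- t) ('X - z%:P) ->
  \sum_(z <- spectrum A) phi z + \sum_(z <- s) phi z = \sum_(z <- t) phi z.
Proof.
rewrite spectrumP -!big_cat => /prod_XsubC_eq st.
exact: perm_big.
Qed.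

Lemma size_spectrum (n : nat) (A : 'M[algC]_n) : size (spectrum A) = n.
Proof.
have := size_char_poly A; rewrite spectrumP size_prod_XsubC => - [].
by [].
Qed.

Lemma sum_spectrum (n : nat) (A : 'M[algC]_n) :
  \sum_(z <- spectrum A) z = \tr A.
Proof.
case: n A => [|n] A.
  have /size0nil -> := size_spectrum A.
  by rewrite big_nil /mxtrace big_ord0.
apply: oppr_inj; rewrite -char_poly_trace // spectrumP.
by rewrite -[in LHS]coefPn_prod_XsubC size_spectrum.
Qed.

(** The deviations of the eigenvalues from [c] have sum zero, so those of the
eigenvalues other than [mu] add up to [c - mu]. *)
Lemma abs_dev_sum_ge (n : nat) (A : 'M[algC]_n) (mu c : algC) :
  eigenvalue A mu -> \tr A = c *+ n ->
  2 * `|mu - c| <= abs_dev_sum (spectrum A) c.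
Proof.
rewrite eigenvalue_root_char spectrumP root_prod_XsubC => mu_in trA.
have sum0 : \sum_(z <- spectrum A) (z - c) = 0.
  rewrite big_split /= sum_spectrum trA big_const_seq count_predT size_spectrum.
  by rewrite iter_addr_0 mulNrn subrr.
rewrite /abs_dev_sum; move: sum0; rewrite !(big_rem _ mu_in) /= => /eqP.
rewrite addr_eq0 => /eqP muc; rewrite mulr_natl mulr2n lerD2l muc normrN.
exact: ler_norm_sum.
Qed.

(** * Disjoint unions of stars *)

Lemma char_poly_sum_blocks (R : comNzRingType) (T L : finType)
    (m : T + L -> T + L -> R) :
  char_poly (\matrix_(i, j < #|{: T + L}|) m (enum_val i) (enum_val j))
  = char_poly (block_mx
      (\matrix_(i < #|T|, j < #|T|) m (inl (enum_val i)) (inl (enum_val j)))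
      (\matrix_(i < #|T|, j < #|L|) m (inl (enum_val i)) (inr (enum_val j)))
      (\matrix_(i < #|L|, j < #|T|) m (inr (enum_val i)) (inl (enum_val j)))
      (\matrix_(i < #|L|, j < #|L|) m (inr (enum_val i)) (inr (enum_val j)))).
Proof.
pose v (k : 'I_(#|T| + #|L|)) : T + L :=
  match split k with inl i => inl (enum_val i) | inr j => inr (enum_val j) end.
have bij_v : bijective v.
  exists (fun u => match u with inl x => lshift _ (enum_rank x)
                              | inr y => rshift _ (enum_rank y) end).
    move=> k; rewrite /v -[k in RHS]splitK.
    by case: (split k) => i /=; rewrite enum_valK.
  rewrite /v; case=> [x|y].
    by rewrite (unsplitK (inl _)) enum_rankK.
  by rewrite (unsplitK (inr _)) enum_rankK.
have bij_g : bijective (enum_rank \o v).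
  by apply: bij_comp (enum_rank_bij _) bij_v.
rewrite -(char_poly_reindex _ bij_g); congr char_poly.
apply/matrixP => i j; rewrite !mxE /= !enum_rankK /v.
by case: (split i) => i'; rewrite !mxE; case: (split j) => j'; rewrite !mxE.
Qed.

Lemma big_enum_val_card (R : Type) (idx : R) (op : Monoid.com_law idx)
    (I : finType) (F : I -> R) :
  \big[op/idx]_(j < #|I|) F (enum_val j) = \big[op/idx]_x F x.
Proof. by rewrite -(big_enum_val (A := I) F); apply: eq_bigl. Qed.

(** A map [f] from [T] to [L] is seen as the union of stars in which [t] is a
leaf attached to the centre [f t]. *)
Section StarForest.

Variables (T L : finType) (f : T -> L).

Definition nleaves (h : L) : nat := #|[set t | f t == h]|.

Definition incidence_mx : 'M[algC]_(#|T|, #|L|) :=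
  \matrix_(i, j) (enum_val j == f (enum_val i))%:R.

Definition nleaves_row : 'rV[algC]_#|L| := \row_j (nleaves (enum_val j))%:R.

Lemma incidence_gram : incidence_mx^T *m incidence_mx = diag_mx nleaves_row.
Proof.
apply/matrixP => i j; rewrite !mxE.
under eq_bigr => k _ do rewrite !mxE.
rewrite (big_enum_val_card _
  (fun t => (enum_val i == f t)%:R * (enum_val j == f t)%:R)).
have [<-|ij] := eqVneq i j.
  rewrite mulr1n /nleaves -sum1dep_card natr_sum [RHS]big_mkcond /=.
  by apply: eq_bigr => t _; rewrite eq_sym; case: eqP; rewrite ?mulr1 ?mulr0.
rewrite mulr0n big1 // => t _; have [<-|] := eqVneq; last by rewrite mul0r.
by rewrite (inj_eq enum_val_inj) eq_sym (negPf ij) mulr0.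
Qed.

Lemma sum_nleaves : (\sum_h nleaves h)%N = #|T|.
Proof.
rewrite -sum1_card (partition_big f predT) //=; apply: eq_bigr => h _.
by rewrite /nleaves -sum1dep_card.
Qed.

(** The adjacency matrix is the case [a = 0], [b = 1], [g = 0]; the Laplacian
and the signless Laplacian are the cases [a = 1], [g = nleaves] with [b = -1]
and [b = 1] respectively, leaves having degree one. *)
Definition star_weight (a b : algC) (g : L -> algC) (u v : T + L) : algC :=
  match u, v with
  | inl s, inl t => a *+ (s == t)
  | inr h, inr k => g h *+ (h == k)
  | inl t, inr h | inr h, inl t => b * (h == f t)%:R
  end.

(** The common neighbourhood matrix: two distinct leaves share a neighbour
exactly when they lie on the same star, and no other two vertices do. *)
Definition clique_weight (u v : T + L) : algC :=
  match u, v with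
  | inl s, inl t => (f s == f t)%:R - (s == t)%:R
  | _, _ => 0
  end.

Definition vertex_mx (m : T + L -> T + L -> algC) : 'M[algC]_#|{: T + L}| :=
  \matrix_(i, j) m (enum_val i) (enum_val j).

Lemma char_poly_star_weight (a b : algC) (g : L -> algC) :
  char_poly (vertex_mx (star_weight a b g))
  = char_poly (block_mx a%:M (b *: incidence_mx) (b *: incidence_mx^T)
                        (diag_mx (\row_j g (enum_val j)))).
Proof.
rewrite char_poly_sum_blocks; congr char_poly; congr block_mx.
all: by apply/matrixP => i j; rewrite !mxE /= ?(inj_eq enum_val_inj).
Qed.

Lemma char_poly_clique_weight :
  char_poly (vertex_mx clique_weight)
  = char_poly (block_mx (incidence_mx *m incidence_mx^T - 1%:M) 0 0
                        (0 : 'M_#|L|)).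
Proof.
rewrite char_poly_sum_blocks; congr char_poly; congr block_mx.
all: apply/matrixP => i j; rewrite !mxE //=.
rewrite (inj_eq enum_val_inj); congr (_ - _).
under eq_bigr => k _ do rewrite !mxE.
rewrite (big_enum_val_card _
  (fun h => (h == f (enum_val i))%:R * (h == f (enum_val j))%:R)).
rewrite (bigD1 (f (enum_val i))) //= eqxx mul1r big1 ?addr0 // => h.
by move=> /negPf->; rewrite mul0r.
Qed.

(** [r h] and [s h] are the two eigenvalues that the star at [h] has besides
[a]. The latter has multiplicity [nleaves h - 1] there, which is negative for
an isolated centre; this is why the [#|L|] copies of [a] stand on the left. *)
Lemma sum_spectrum_star (a b : algC) (g r s : L -> algC)
    (phi : algC -> algC) :
    (forall h, r h + s h = a + g h) ->
    (forall h, r h * s h = a * g h - b ^+ 2 * (nleaves h)%:R) ->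
  \sum_(z <- spectrum (vertex_mx (star_weight a b g))) phi z + phi a *+ #|L|
  = phi a *+ #|T| + \sum_h (phi (r h) + phi (s h)).
Proof.
move=> rDs rMs.
have := @sum_spectrum_factored _ (vertex_mx (star_weight a b g))
  (nseq #|L| a)
  (nseq #|T| a ++ (map r (index_enum L) ++ map s (index_enum L))) phi.
rewrite !big_cat !big_nseq !big_map /= !iter_addr_0 !iter_mulr_1.
rewrite [in X in _ -> X]big_split /=; apply.
rewrite char_poly_star_weight -big_split /=.
have := char_poly_star (\row_j g (enum_val j)) a b incidence_gram.
under [in X in X -> _]eq_bigr => j _ do rewrite !mxE.
rewrite (big_enum_val_card _ (fun h =>
  ('X - a%:P) * ('X - (g h)%:P) - (b ^+ 2 * (nleaves h)%:R)%:P)).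
move=> H; rewrite [X in _ = _ * X](_ : _ = \prod_h
  (('X - a%:P) * ('X - (g h)%:P) - (b ^+ 2 * (nleaves h)%:R)%:P)); last first.
  apply: eq_bigr => h _.
  have -> : b ^+ 2 * (nleaves h)%:R = a * g h - r h * s h.
    by rewrite rMs opprB addrC subrK.
  have -> : g h = r h + s h - a by rewrite rDs addrC addKr.
  by rewrite !(polyCM, polyCD, polyCN); ring.
exact: H.
Qed.

Lemma sum_spectrum_cliques (phi : algC -> algC) :
  \sum_(z <- spectrum (vertex_mx clique_weight)) phi z + phi (- 1) *+ #|L|
  = phi 0 *+ #|L| + phi (- 1) *+ #|T| + \sum_h phi ((nleaves h)%:R - 1).
Proof.
have := @sum_spectrum_factored _ (vertex_mx clique_weight)
  (nseq #|L| (- 1)) (nseq #|L| 0 ++ nseq #|T| (- 1) ++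
    map (fun h => (nleaves h)%:R - 1) (index_enum L)) phi.
rewrite !big_cat !big_nseq !big_map /= !iter_addr_0 !iter_mulr_1.
rewrite addrA; apply; rewrite char_poly_clique_weight polyCN opprK subr0.
have := char_poly_cliques incidence_gram.
under [in X in X -> _]eq_bigr => j _ do rewrite !mxE.
rewrite (big_enum_val_card _ (fun h => 'X + 1 - ((nleaves h)%:R)%:P)).
move=> H; rewrite mulrA [X in _ = _ * X](_ : _ = \prod_h
  ('X + 1 - ((nleaves h)%:R)%:P)); last first.
  by apply: eq_bigr => h _; rewrite polyCB opprB addrA.
exact: H.
Qed.
End StarForest.

(** * Complete graphs *)

(** The diagonal value [p] is the mean of the eigenvalues, and the all-ones
vector has eigenvalue [p + q *+ n.-1]. *)
Lemma abs_dev_sum_two_valued (n : nat) (A : 'M[algC]_n) (p q : algC) :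
  (0 < n)%N -> (forall i j, A i j = if i == j then p else q) ->
  2 * `|q *+ n.-1| <= abs_dev_sum (spectrum A) p.
Proof.
case: n A => // n A _ Apq.
rewrite -[q *+ _](addKr p) addrC; apply: abs_dev_sum_ge; last first.
  rewrite /mxtrace; under eq_bigr => i _ do rewrite Apq eqxx.
  by rewrite sumr_const card_ord.
apply/eigenvalueP; exists (const_mx 1); last first.
  by apply/eqP => /rowP/(_ 0); rewrite !mxE => /eqP; rewrite oner_eq0.
apply/rowP => j; rewrite !mxE mulr1 (bigD1 j) //= !mxE mul1r Apq eqxx.
congr (_ + _); rewrite (eq_bigr (fun _ => q)); last first.
  by move=> i /negPf ij; rewrite !mxE mul1r Apq ij.
by rewrite sumr_const cardC1 card_ord.
Qed.

Section CompleteGraphEnergies.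
Variable n : nat.
Hypothesis n_gt0 : (0 < n)%N.
Let K := complete_graph n.

Lemma abs_dev_sum_complete_ge (A : 'M[algC]_#|K|) (p q : algC) :
  (forall i j, A i j = if i == j then p else q) ->
  2 * `|q *+ n.-1| <= abs_dev_sum (spectrum A) p.
Proof.
have -> : n.-1 = #|K|.-1 by rewrite [#|K|]card_ord.
by apply: abs_dev_sum_two_valued; rewrite [#|K|]card_ord.
Qed.

Lemma degree_complete (x : K) : degree x = n.-1.
Proof.
rewrite /degree -[n in RHS]card_ord -(cardsC1 x); apply: eq_card => y.
by rewrite !inE /= /complete_adj eq_sym.
Qed.

Lemma common_neighbors_complete (x y : K) :
  x != y -> #|common_neighbors x y| = (n - 2)%N.
Proof.
move=> xy; have <- : #|[set x; y]| = 2%N by rewrite cards2 xy.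
rewrite cardsCs [#|K|]card_ord; congr (_ - _)%N; apply: eq_card => z.
rewrite !inE /= /complete_adj ![_ == z]eq_sym.
by case: (z == x); case: (z == y).
Qed.

Lemma average_degree_complete : average_degree K = n.-1%:R.
Proof.
rewrite /average_degree [#|K|]card_ord.
have -> : edges K = [set A : {set 'I_n} | #|A| == 2].
  apply/setP => A; rewrite inE; apply/imset2P/cards2P.
    by case=> x y _; rewrite inE => /andP[_ xy] ->; exists x, y.
  by case=> x [y [xy ->]]; exists x y; rewrite ?inE.
rewrite card_draws card_ord mulnC bin_ffact !ffactnS ffactn0 muln1.
by rewrite natrM mulrAC divff ?mul1r // pnatr_eq0 -lt0n.
Qed.

Lemma energy_complete_ge : 2 * n.-1%:R <= energy K.
Proof.
have := @abs_dev_sum_complete_ge (adjacency_mx K) 0 1.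
rewrite normr_nat /abs_dev_sum; under eq_bigr => z _ do rewrite subr0.
apply=> i j; rewrite mxE /= /complete_adj (inj_eq enum_val_inj).
by case: eqP.
Qed.

Lemma laplacian_energy_complete_ge : 2 * n.-1%:R <= laplacian_energy K.
Proof.
rewrite /laplacian_energy average_degree_complete.
have := @abs_dev_sum_complete_ge (degree_mx K - adjacency_mx K) n.-1%:R (-1).
rewrite mulNrn normrN normr_nat; apply=> i j.
rewrite !mxE degree_complete /= /complete_adj (inj_eq enum_val_inj).
by case: eqP; rewrite ?subr0 ?sub0r.
Qed.

Lemma signless_laplacian_energy_complete_ge :
  2 * n.-1%:R <= signless_laplacian_energy K.
Proof.
rewrite /signless_laplacian_energy average_degree_complete.
have := @abs_dev_sum_complete_ge (degree_mx K + adjacency_mx K) n.-1%:R 1.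
rewrite normr_nat; apply=> i j.
rewrite !mxE degree_complete /= /complete_adj (inj_eq enum_val_inj).
by case: eqP; rewrite ?addr0 ?add0r.
Qed.

Lemma CN_energy_complete_ge : 2 * (n.-1 * (n - 2))%:R <= CN_energy K.
Proof.
have := @abs_dev_sum_complete_ge (common_neighborhood_mx K) 0 (n - 2)%:R.
rewrite -mulrnA normr_nat (mulnC n.-1) /abs_dev_sum.
under eq_bigr => z _ do rewrite subr0.
apply=> i j; rewrite mxE; have [//|ij] := eqVneq i j.
by rewrite common_neighbors_complete // (inj_eq enum_val_inj).
Qed.

End CompleteGraphEnergies.

(** * The subgroup generating bipartite graph *)

(** The difference of the two sides is the square of [sqrtC d%:R - 1]. *)
Lemma double_sqrtC_leif (d : nat) :
  2 * sqrtC d%:R <= d%:R + 1 ?= iff (d == 1)%N :> algC.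
Proof.
have rr : sqrtC d%:R - 1 \is @Num.real algC.
  by rewrite rpredB ?rpred1 // ger0_real // sqrtC_ge0.
have e : d%:R + 1 - 2 * sqrtC d%:R = (sqrtC d%:R - 1) ^+ 2 :> algC.
  by rewrite -{1}[d%:R]sqrtCK; ring.
split; first by rewrite -subr_ge0 e real_exprn_even_ge0.
rewrite eq_sym -subr_eq0 e sqrf_eq0 subr_eq0 -[X in _ == X]sqrtC1.
by rewrite eqr_sqrtC ?ler0n ?ler01 // pnatr_eq1.
Qed.

Section SubgroupGeneratingGraph.
Variable gT : finGroupType.
Let S := sgb_graph gT.
Let T : finType := (gT * gT)%type.
Let L : finType := {group gT}.

Definition generated (p : gT * gT) : {group gT} := <<[set p.1; p.2]>>%G.

Let d := nleaves generated.
Let n := #|T|.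
Let l := #|L|.

Lemma card_sgb_graph : #|S| = (n + l)%N.
Proof. by rewrite card_sum. Qed.

Lemma pairs_gt0 : (0 < n)%N.
Proof. by apply/card_gt0P; exists (1%g, 1%g). Qed.

Lemma subgroups_gt0 : (0 < l)%N.
Proof. by apply/card_gt0P; exists 1%G. Qed.

Lemma card_edges_sgb : #|edges S| = n.
Proof.
pose e (p : T) : {set S} := [set inl p; inr (generated p)].
have inj_e : injective e.
  move=> p q /setP/(_ (inl p)); rewrite !inE eqxx /= orbF.
  by move/esym/eqP => [].
rewrite /n -cardsT -(card_imset _ inj_e); congr #|pred_of_set _|.
apply/setP => A; apply/imset2P/imsetP.
  case=> [] [[a b]|H] [[a' b']|H'] _; rewrite inE //= => /eqP-> ->.
    by exists (a, b); rewrite ?inE.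
  by exists (a', b'); rewrite ?inE //; apply: setUC.
case=> [] [a b] _ ->; exists (inl (a, b)) (inr (generated (a, b))) => //.
by rewrite inE /=.
Qed.

Lemma degree_sgb (u : S) :
  degree u = match u with inl _ => 1%N | inr H => d H end.
Proof.
rewrite /degree; case: u => [[a b]|H].
  rewrite -(cards1 (inr (generated (a, b)) : S)); apply: eq_card.
  by case=> [[c e]|K]; rewrite !inE.
rewrite /d /nleaves -(card_imset _ (@inl_inj T L)); apply: eq_card.
case=> [[a b]|K]; rewrite !inE /=.
  by rewrite mem_imset ?inE 1?eq_sym //; apply: inl_inj.
by apply/esym/imsetP; case.
Qed.

Lemma common_neighbors_sgb (u v : S) :
  u != v -> #|common_neighbors u v| =
    match u, v with
    | inl p, inl q => generated p == generated q
    | _, _ => false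
    end.
Proof.
case: u v => [[a b]|H] [[a' b']|K] uv.
- have [ee|ne] := eqVneq.
    apply: etrans (cards1 (inr (generated (a, b)) : S)); apply: eq_card.
    move=> [[x y]|H]; rewrite !inE /= ?andbF //.
    have -> : <<[set a'; b']>>%G = generated (a, b) := esym ee.
    by rewrite andbb.
  apply: eq_card0 => - [[x y]|H]; rewrite !inE /= ?andbF //.
  apply: contraNF ne => /andP[/eqP e1 /eqP e2]; apply/eqP.
  exact: etrans (esym e1) e2.
- by apply: eq_card0 => - [[x y]|H]; rewrite !inE /= ?andbF.
- by apply: eq_card0 => - [[x y]|H']; rewrite !inE /= ?andbF.
- apply: eq_card0 => - [[x y]|H']; rewrite !inE /= ?andbF //.
  by apply: contraNF uv => /andP[/eqP -> /eqP ->].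
Qed.

Lemma energy_sgb : energy S = \sum_H 2 * sqrtC (d H)%:R.
Proof.
pose r H : algC := sqrtC (d H)%:R.
have rDN H : r H + - r H = 0 + 0 by rewrite addr0 subrr.
have rMN H : r H * - r H = 0 * 0 - 1 ^+ 2 * (d H)%:R.
  by rewrite mul0r sub0r expr1n mul1r mulrN -expr2 sqrtCK.
have := sum_spectrum_star (fun z => `|z|) rDN rMN.
rewrite normr0 !mul0rn add0r addr0.
have -> : vertex_mx (star_weight generated 0 1 (fun=> 0)) = adjacency_mx S.
  apply/matrixP => i j; rewrite !mxE.
  by case: (enum_val i) (enum_val j) => [[a b]|H] [[a' b']|K] //=;
    rewrite ?mul0rn ?mul1r.
rewrite /energy => ->; apply: eq_bigr => H _.
by rewrite normrN ger0_norm ?sqrtC_ge0 // mulr_natl mulr2n.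
Qed.

(** Both Laplacians are treated at once, [s = -1] giving [D - A] and [s = 1]
giving [D + A]: only [s ^+ 2] enters the characteristic polynomial, as for every
bipartite graph. *)
Lemma abs_dev_sum_laplacian_sgb (s c : algC) (A : 'M[algC]_#|S|) :
  s ^+ 2 = 1 -> A = degree_mx S + s *: adjacency_mx S ->
  abs_dev_sum (spectrum A) c + `|1 - c| * l%:R
  = `|1 - c| * n%:R + \sum_H (`|c| + `|(d H)%:R + 1 - c|).
Proof.
move=> s2 ->.
have rD (H : L) : 0 + ((d H)%:R + 1) = 1 + (d H)%:R :> algC.
  by rewrite add0r addrC.
have rM (H : L) : 0 * ((d H)%:R + 1) = 1 * (d H)%:R - s ^+ 2 * (d H)%:R.
  by rewrite mul0r s2 subrr.
have := sum_spectrum_star (fun z => `|z - c|) rD rM.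
have -> : vertex_mx (star_weight generated 1 s (fun H => (d H)%:R))
    = degree_mx S + s *: adjacency_mx S.
  apply/matrixP => i j; rewrite !mxE degree_sgb -(inj_eq enum_val_inj).
  by case: (enum_val i) (enum_val j) => [[a b]|H] [[a' b']|K] //=;
    rewrite ?mulr0 ?addr0 ?add0r.
by rewrite sub0r normrN !mulr_natr.
Qed.

Lemma CN_energy_sgb :
  CN_energy S + l%:R = n%:R + \sum_H `|(d H)%:R - 1|.
Proof.
have := @sum_spectrum_cliques _ _ generated (fun z => `|z|).
rewrite normr0 mul0rn add0r normrN normr1.
have -> //: vertex_mx (clique_weight generated) = common_neighborhood_mx S.
apply/matrixP => i j; rewrite !mxE; have [<-|ij] := eqVneq i j.
  by case: (enum_val i) => [[a b]|H] //=; rewrite !eqxx subrr.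
have uv : enum_val i != enum_val j by rewrite (inj_eq enum_val_inj).
rewrite common_neighbors_sgb //; move: uv.
case: (enum_val i) (enum_val j) => [[a b]|H] [[a' b']|K] //= uv.
by rewrite [(a, b) == (a', b')](negPf uv) subr0.
Qed.

Lemma average_degree_sgb : average_degree S = (2 * n)%:R / (n + l)%:R.
Proof. by rewrite /average_degree card_edges_sgb card_sgb_graph. Qed.

Lemma sum_star_sizes : \sum_H (d H)%:R = n%:R :> algC.
Proof. by rewrite -natr_sum sum_nleaves. Qed.

(** Whether the average degree [c] exceeds [1] is decided by comparing [n] with
[l], as [c - 1] has the sign of [n - l]. *)
Lemma laplacian_energies_sgb_le (s : algC) (A : 'M[algC]_#|S|) :
  s ^+ 2 = 1 -> A = degree_mx S + s *: adjacency_mx S ->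
  abs_dev_sum (spectrum A) (average_degree S) <= 2 * (n + l).-1%:R.
Proof.
move=> s2 /(abs_dev_sum_laplacian_sgb (average_degree S) s2).
set E := abs_dev_sum _ _; set c := average_degree S.
have c0 : 0 <= c by rewrite /c average_degree_sgb divr_ge0 ?ler0n.
have cE : c * (n%:R + l%:R) = 2 * n%:R.
  rewrite /c average_degree_sgb -natrD divfK ?natrM //.
  by rewrite pnatr_eq0 addn_eq0 negb_and -lt0n pairs_gt0.
have -> : 2 * (n + l).-1%:R = 2 * n%:R + 2 * l%:R - 2 :> algC.
  by rewrite -subn1 natrB ?natrD; [ring | rewrite addn_gt0 pairs_gt0].
move=> EE.
have {EE} Ele : E <= `|1 - c| * n%:R + c * l%:R + n%:R.
  rewrite -(lerD2r (`|1 - c| * l%:R)) EE.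
  (* The bound is the exact value of E with each |d_H + 1 - c| replaced by
     d_H + |1 - c|. *)
  have -> : `|1 - c| * n%:R + c * l%:R + n%:R + `|1 - c| * l%:R
      = `|1 - c| * n%:R + \sum_H (c + ((d H)%:R + `|1 - c|)).
    rewrite !big_split /= sum_star_sizes !sumr_const -[#|_|]/l.
    by rewrite -(mulr_natr c) -(mulr_natr `|1 - c|); ring.
  rewrite lerD2l; apply: ler_sum => H _; rewrite (ger0_norm c0) lerD2l -addrA.
  by apply: (le_trans (ler_normD _ _)); rewrite normr_nat.
apply: (le_trans Ele).
have l1 : 1 <= l%:R :> algC by rewrite ler1n subgroups_gt0.
have n1 : 1 <= n%:R :> algC by rewrite ler1n pairs_gt0.
have nl0 : 0 < n%:R + l%:R :> algC.
  by rewrite addr_gt0 // ltr0n ?pairs_gt0 ?subgroups_gt0.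
have [ln|nl] := leqP l n.
  have c1 : 1 <= c.
    rewrite -(ler_pM2r nl0) cE mul1r mulr_natl mulr2n lerD2l.
    by rewrite ler_nat.
  rewrite distrC ger0_norm ?subr_ge0 //.
  rewrite (_ : _ + n%:R = c * (n%:R + l%:R)); last by ring.
  by rewrite cE -addrA lerDl subr_ge0 -[X in X <= _]mulr1 ler_pM2l.
have c1 : c <= 1.
  rewrite -(ler_pM2r nl0) cE mul1r mulr_natl mulr2n lerD2l.
  by rewrite ler_nat ltnW.
rewrite ger0_norm ?subr_ge0 //.
rewrite (_ : _ + n%:R = 2 * n%:R + c * (l%:R - n%:R)); last by ring.
rewrite -addrA lerD2l.
apply: (@le_trans _ _ (l%:R - n%:R)).
  by rewrite ler_piMl // subr_ge0 ler_nat ltnW.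
rewrite -subr_ge0 (_ : _ - _ = (l%:R - 1) + (n%:R - 1)); last by ring.
by rewrite addr_ge0 // subr_ge0.
Qed.

(** The subgroup generated by [x != 1] arises from [(x, 1)] and from [(1, x)],
and such a star with at least two leaves makes the inequality between the
geometric and the arithmetic mean strict. *)
Lemma energy_sgb_lt (nontrivial : (1 < #|gT|)%N) : energy S < #|S|%:R.
Proof.
have [x x1] : exists x : gT, x != 1%g.
  have /card_gt0P[x] : (0 < #|[set~ (1 : gT)%g]|)%N.
    by rewrite cardsC1 -ltnS prednK // ltnW.
  by rewrite !inE; exists x.
pose H := generated (x, 1%g).
have dH : (1 < d H)%N.
  apply: (@leq_trans #|[set (x, 1%g); (1%g, x)]|).
    by rewrite cards2 xpair_eqE (negPf x1).
  apply: subset_leq_card; apply/subsetP => p; rewrite !inE.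
  by case/orP => /eqP ->; rewrite // /H /generated /= setUC.
rewrite energy_sgb card_sgb_graph natrD -sum_star_sizes.
rewrite (_ : l%:R = \sum_(H : L) 1); last by rewrite sumr_const.
rewrite -big_split /= (bigD1 H) //= [ltRHS](bigD1 H) //=; apply: ltr_leD.
  by rewrite (lt_leif (double_sqrtC_leif _)) gtn_eqF.
by apply: ler_sum => K _; apply: double_sqrtC_leif.
Qed.

Lemma CN_energy_sgb_le (nontrivial : (1 < #|gT|)%N) :
  CN_energy S <= 2 * ((n + l).-1 * (n + l - 2))%:R.
Proof.
have le2n : CN_energy S <= 2 * n%:R.
  rewrite -(lerD2r l%:R) CN_energy_sgb mulr_natl mulr2n -addrA lerD2l.
  rewrite -[in leRHS]sum_star_sizes (_ : l%:R = \sum_(H : L) 1); last first.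
    by rewrite sumr_const.
  rewrite -big_split; apply: ler_sum => H _.
  by apply: (le_trans (ler_normB _ _)); rewrite normr_nat normr1.
apply: (le_trans le2n); rewrite ler_pM2l // ler_nat.
have n4 : (3 < n)%N by rewrite /n card_prod; apply: (@leq_mul 2 2).
have := subgroups_gt0; nia.
Qed.
End SubgroupGeneratingGraph.

(** * The dicyclic group *)

(** Sending [a] to the identity and [b] to a generator defines a homomorphism
onto the group of order two: the relations reduce to [1 = 1] and
[b ^+ 2 = 1]. *)
Lemma dicyclic_nontrivial (m : nat) (gT : finGroupType) :
  is_dicyclic m gT -> (1 < #|gT|)%N.
Proof.
move=> hG; have : ([set: 'Z_2] \homg [set: gT])%g.
  rewrite hG; apply/existsP; exists (1%g, Zp1); rewrite /= !xpair_eqE /=.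
  apply/and4P; split.
  - by rewrite cycle1 joing1G; apply/eqP/esym/Zp_cycle.
  - by rewrite expg1n.
  - by rewrite expg1n; apply/eqP/val_inj.
  - by rewrite mulg1 mulgV invg1.
by move/leq_homg; rewrite !cardsT card_ord.
Qed.

Theorem theorem4p6 (p : nat) (gT : finGroupType) (hp : prime p)
    (hG : is_dicyclic (p ^ 2) gT) :
  [/\ hypoenergetic (sgb_graph gT),
      ~~ hyperenergetic (sgb_graph gT),
      ~~ L_hyperenergetic (sgb_graph gT),
      ~~ Q_hyperenergetic (sgb_graph gT)
    & ~~ CN_hyperenergetic (sgb_graph gT)].
Proof.
have gT1 := dicyclic_nontrivial hG.
have N0 : (0 < #|sgb_graph gT|)%N by rewrite card_sgb_graph addn_gt0 pairs_gt0.
have N1 : (1 < #|sgb_graph gT|)%N.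
  by rewrite card_sgb_graph (leq_add (pairs_gt0 gT) (subgroups_gt0 gT)).
have notgt (x y z : algC) : x <= y -> y <= z -> ~~ (z < x).
  by move=> xy yz; apply/negP => /(le_lt_trans (le_trans xy yz)); rewrite ltxx.
split.
- exact: energy_sgb_lt.
- apply: notgt (energy_complete_ge N0).
  apply: (le_trans (ltW (energy_sgb_lt gT1))).
  by rewrite -natrM ler_nat; lia.
- apply: notgt (laplacian_energy_complete_ge N0); rewrite card_sgb_graph.
  apply: (@laplacian_energies_sgb_le _ (-1)); first by rewrite sqrrN expr1n.
  by rewrite scaleN1r.
- apply: notgt (signless_laplacian_energy_complete_ge N0).
  rewrite card_sgb_graph.
  by apply: (@laplacian_energies_sgb_le _ 1); rewrite ?expr1n ?scale1r.
- apply: notgt (CN_energy_complete_ge N0); rewrite card_sgb_graph.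
  exact: CN_energy_sgb_le.
Qed.
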